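(* Let $\kappa$ be a cardinal with $\kappa^{<\kappa}=\kappa$, let $\mathcal L$ be a relational language with $|\mathcal L|<\kappa$, and let $\mathcal K\subseteq\mathrm{Mod}^\kappa_{\mathcal L}$ be an invariant set. Suppose there is a well-founded tree $\mathrm{Tr}$ of size $\le\kappa$ with $\varrho(\mathrm{Tr})=\beta+1$ such that for all $\mathcal M,\mathcal N\in\mathcal K$, $\mathcal M\cong\mathcal N$ if and only if player II has a winning strategy in $\mathrm{EF}^\kappa_{\mathrm{Tr}}(\mathcal M,\mathcal N)$. Then ${\cong^\kappa_{\mathcal K}}\in\boldsymbol\Pi^0_{2\beta}(\mathcal K^2)$; in particular $\mathrm{rk}_B(\cong^\kappa_{\mathcal K})\le2\beta$.
   Context: ${}^\kappa\kappa$ has the bounded topology (basic sets $N_p=\{x:p\subseteq x\}$, $p\in{}^{<\kappa}\kappa$). Borel classes on $X$ homeomorphic to a subspace of ${}^\kappa\kappa$: $\boldsymbol\Sigma^0_1$ open, $\boldsymbol\Pi^0_1$ closed, $\boldsymbol\Sigma^0_\alpha$ ($\alpha\ge2$) = $\kappa$-unions of sets in $\bigcup_{1\le\beta<\alpha}\boldsymbol\Pi^0_\beta$, $\boldsymbol\Pi^0_\alpha$ = complements; $\boldsymbol\Pi^0_0=\boldsymbol\Delta^0_1$ (clopen). $\mathrm{rk}_B(A)=0$ if clopen, else least $\alpha\ge1$ with $A\in\boldsymbol\Sigma^0_\alpha\cup\boldsymbol\Pi^0_\alpha$. $\mathrm{Mod}^\kappa_{\mathcal L}$ = $\mathcal L$-structures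 with domain $\kappa$, topology generated by $N_{\mathcal Q}=\{\mathcal M:\mathcal Q$ is a substructure of $\mathcal M\}$ for $\mathcal Q$ an $\mathcal L$-structure with domain bounded in $\kappa$ (since $|\mathcal L|<\kappa$). Invariant = closed under isomorphism; $\cong^\kappa_{\mathcal K}$ is the isomorphism relation on $\mathcal K$ as a subset of $\mathcal K^2$ with the relative topology. Trees: partial order with a unique minimal element (root), predecessors of each node a finite linear order; well-founded = no infinite chain. Node rank: leaves have rank $0$, otherwise $\varrho_{\mathrm{Tr}}(p)=\sup\{\varrho_{\mathrm{Tr}}(q)+1:p<q\}$; $\varrho(\mathrm{Tr})=\varrho_{\mathrm{Tr}}(\text{root})+1$. EF game $\mathrm{EF}^\kappa_{\mathrm{Tr}}(\mathcal M,\mathcal N)$: at round $n$, I picks a node $p_n$ which is an immediate successor of $p_{n-1}$ (of the root if $n=0$) and $C_n\subseteq\kappa$ with $|C_n|<\kappa$, $C_n\supseteq C_i$ ($i<n$); II picks a partial $f_n:\kappa\to\kappa$ with $|\mathrm{dom}f_n|<\kappa$, $\mathrm{dom}f_n\cap\mathrm{ran}f_n\supseteq C_n$, $f_n\supseteq f_i$ ($i<n$). The game ends when I cannot move; II wins iff $\bigcup_i f_i$ is a partial isomorphism from $\mathcal M$ to $\mathcal N$. *)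

(* Defs.v *)
From HB Require Import structures.
From mathcomp Require Import all_boot all_order all_algebra.
From mathcomp Require Import all_classical wochoice.
From mathcomp Require Import topology.

Set Implicit Arguments.
Unset Strict Implicit.
Unset Printing Implicit Defensive.

Import Order.TTheory.

Local Open Scope classical_set_scope.
Local Open Scope card_scope.
Local Open Scope order_scope.

(* [osup f] is the least ordinal strictly greater than every [f i], i.e.
   sup {f i + 1 : i}.  Distinct terms may denote the same ordinal, so equality
   of ordinals is [oeq], not Leibniz equality. *)
Inductive ord : Type := osup : forall U : Type, (U -> ord) -> ord.

Fixpoint ole (a b : ord) : Prop :=
  match a with
  | osup _ f => forall i, match b with osup _ g => exists j, ole (f i) (g j) end
  end.

Definition osucc (a : ord) : ord := osup (fun _ : unit => a).
Definition olt (a b : ord) : Prop := ole (osucc a) b.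
Definition oeq (a b : ord) : Prop := ole a b /\ ole b a.

Definition ozero : ord := osup (fun e : Empty_set => match e with end).
Definition oone : ord := osucc ozero.
Definition otwo : ord := osucc oone.

(* [below a] indexes a family of ordinals cofinal below [a]. *)
Definition below (a : ord) : Type := match a with osup U _ => U end.
Definition below_val (a : ord) : below a -> ord :=
  match a with osup _ f => f end.

Definition olub (J : Type) (h : J -> ord) : ord :=
  osup (fun x : {j : J & below (h j)} => below_val (projT2 x)).

Fixpoint oadd (a b : ord) : ord :=
  match b with
  | osup J g =>
      osup (fun x : below a + J =>
        match x with inl i => below_val i | inr j => oadd a (g j) end)
  end.

(* Usual ordinal product: [omul a b] is [b] consecutive copies of [a], so that
   2 * omega = omega. *)
Fixpoint omul (a b : ord) : ord :=
  match b with osup J g => olub (fun j => oadd (omul a (g j)) a) end.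

Definition card_lt (T U : Type) (A : set T) (B : set U) : bool :=
  (A #<= B) && (A #!= B).

(* A cardinal is an initial ordinal: its elements are the ordinals below it. *)
Record is_cardinal d (kappa : orderType d) : Prop := {
  cardinal_wo : well_order (<=%O : rel kappa);
  cardinal_initial : forall a : kappa,
    card_lt [set x : kappa | x < a] [set: kappa] }.

Definition seq_below d (kappa : orderType d) : Type :=
  {a : kappa & [set x : kappa | x < a] -> kappa}.

Definition kappa_lt_kappa d (kappa : orderType d) : Prop :=
  [set: seq_below kappa] #= [set: kappa].

Definition bounded_in d (kappa : orderType d) (D : set kappa) : Prop :=
  exists a : kappa, forall x, D x -> x < a.

(* Only indices a >= 1 occur. The family [F] may repeat sets, so its unions are
   those of at most kappa many sets. *)
Inductive Sigma0 (kappa : Type) (X : topologicalType) (a : ord) (A : set X)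
  : Prop :=
| Sigma0_open of oeq a oone & open A
| Sigma0_union (F : kappa -> set X) (g : kappa -> ord) of
    ole otwo a &
    (forall i, ole oone (g i) /\ olt (g i) a) &
    (forall i, Sigma0 kappa (g i) (~` F i)) &
    A = \bigcup_i F i.

Definition Pi0 (kappa : Type) (X : topologicalType) (a : ord) (A : set X)
  : Prop :=
  (oeq a ozero /\ clopen A) \/ (ole oone a /\ Sigma0 kappa a (~` A)).

Definition Sigma0_or_Pi0 (kappa : Type) (X : topologicalType) (a : ord)
    (A : set X) : Prop :=
  ole oone a /\ (Sigma0 kappa a A \/ Pi0 kappa a A).

(* [rkB kappa A a] : the Borel rank of A is defined and equal to a. *)
Definition rkB (kappa : Type) (X : topologicalType) (A : set X) (a : ord)
  : Prop :=
  (clopen A /\ oeq a ozero) \/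
  [/\ ~ clopen A, Sigma0_or_Pi0 kappa a A &
      forall b, Sigma0_or_Pi0 kappa b A -> ole a b].

Record relational_language : Type := RelationalLanguage {
  symbol :> Type;
  arity : symbol -> nat }.

Definition structure (L : relational_language) (T : Type) : Type :=
  forall R : L, set ('I_(arity R) -> T).

Definition isomorphic (L : relational_language) (T : Type)
    (M N : structure L T) : Prop :=
  exists2 h : T -> T, bijective h &
    forall (R : L) (a : 'I_(arity R) -> T), M R a <-> N R (h \o a).

Definition substructure (L : relational_language) (T : Type) (D : set T)
    (Q : structure L D) (M : structure L T) : Prop :=
  forall (R : L) (a : 'I_(arity R) -> D), Q R a <-> M R (set_val \o a).

Definition Mod d (kappa : orderType d) (L : relational_language) : Type :=
  structure L kappa.

Definition Mod_basic d (kappa : orderType d) (L : relational_language)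
  : set (set (Mod kappa L)) :=
  [set U | exists (D : set kappa) (Q : structure L D),
     bounded_in D /\ U = [set M | substructure Q M]].

HB.instance Definition _ d (kappa : orderType d) (L : relational_language) :=
  gen_eqMixin (Mod kappa L).
HB.instance Definition _ d (kappa : orderType d) (L : relational_language) :=
  gen_choiceMixin (Mod kappa L).
HB.instance Definition _ d (kappa : orderType d) (L : relational_language) :=
  isSubBaseTopological.Build (Mod kappa L) (@Mod_basic d kappa L) id.

Definition invariant_set d (kappa : orderType d) (L : relational_language)
    (K : set (Mod kappa L)) : Prop :=
  forall M N, K M -> isomorphic M N -> K N.

(* The subset [K], used as a type, carries the relative topology. *)
Definition square d (kappa : orderType d) (L : relational_language)
    (K : set (Mod kappa L)) : topologicalType :=
  (set_type K * set_type K)%type.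

Definition iso_rel d (kappa : orderType d) (L : relational_language)
    (K : set (Mod kappa L)) : set (square K) :=
  [set x : square K | isomorphic (set_val x.1) (set_val x.2)].
Arguments iso_rel {d kappa L} K _.

Record is_tree d (T : porderType d) (root : T) : Prop := {
  tree_root : forall x : T, wochoice.minimal (<=%O : rel T) x <-> x = root;
  tree_pred_finite : forall x : T, finite_set [set y : T | y < x];
  tree_pred_linear : forall x : T,
    total_on [set y : T | y < x] (fun y z : T => y <= z) }.

Definition tree_wf d (T : porderType d) : Prop :=
  forall C : set T, total_on C (fun x y : T => x <= y) -> finite_set C.

Lemma tree_wf_gt d (T : porderType d) :
  tree_wf T -> well_founded (fun x y : T => y < x).
Proof.
move=> fin_chain x; apply: contrapT => nAx.
pose bad := {y : T | ~ Acc (fun x y : T => y < x) y}.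
have step (y : bad) : exists z : bad, sval y < sval z.
  apply: contrapT => nz; apply: (svalP y); constructor => z yz.
  by apply: contrapT => nAz; apply: nz; exists (exist _ z nAz).
have [next nextP] := choice step.
pose u n := sval (iter n next (exist _ x nAx)).
have u_lt : {homo u : m n / (m < n)%N >-> m < n}.
  by apply: homo_ltn; [exact: lt_trans | move=> n; exact: nextP].
have u_inj : injective u.
  move=> m n umn; case: (ltngtP m n) => // /u_lt; by rewrite umn ltxx.
have : finite_set (range u).
  apply: fin_chain => _ _ [m _ <-] [n _ <-].
  case: (ltngtP m n) => [/u_lt/ltW|/u_lt/ltW|->]; [by left|by right|by left].
by rewrite (eq_finite_set (inj_card_eq (in2W u_inj))); exact: infinite_nat.
Qed.

(* By the meaning of [osup] this is sup {rank q + 1 : p < q}. *)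
Definition node_rank d (T : porderType d) (wf : tree_wf T) : T -> ord :=
  Fix (tree_wf_gt wf) (fun _ => ord)
    (fun p rec => osup (fun q : {q : T | p < q} => rec (sval q) (svalP q))).

Definition tree_rank d (T : porderType d) (wf : tree_wf T) (root : T) : ord :=
  osucc (node_rank wf root).

Definition immediate_succ d (T : porderType d) (x y : T) : bool :=
  (x < y) && `[< ~ exists z : T, x < z /\ z < y >].

(* A partial function is its graph. *)
Definition is_pfun (T : Type) (f : set (T * T)) : Prop :=
  forall x y z, f (x, y) -> f (x, z) -> y = z.

Definition pdom (T : Type) (f : set (T * T)) : set T := fst @` f.
Definition pran (T : Type) (f : set (T * T)) : set T := snd @` f.

Definition partial_iso (L : relational_language) (T : Type)
    (M N : structure L T) (f : set (T * T)) : Prop :=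
  [/\ is_pfun f,
      forall x y z, f (x, z) -> f (y, z) -> x = y &
      forall (R : L) (a b : 'I_(arity R) -> T),
        (forall i, f (a i, b i)) -> (M R a <-> N R b)].

Section Game.
Context d (kappa : orderType d) d' (T : porderType d') (root : T).

Definition moveI : Type := (T * set kappa)%type.

(* The moves of player I so far, [p_0, C_0], [p_1, C_1], and so on. *)
Definition legalI (s : seq moveI) : bool :=
  [&& path (@immediate_succ _ T) root [seq m.1 | m <- s],
      all (fun m => card_lt m.2 [set: kappa]) s &
      pairwise (fun C C' : set kappa => `[< C `<=` C' >]) [seq m.2 | m <- s]].

Definition completeI (s : seq moveI) : Prop :=
  legalI s /\ forall m, ~ legalI (rcons s m).

(* II's answer after the moves [s] of I; [s] is nonempty when it is used. *)
Definition strategyII : Type := seq moveI -> set (kappa * kappa).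

Definition legalII (sigma : strategyII) : Prop :=
  forall s p C, legalI (rcons s (p, C)) ->
    let f := sigma (rcons s (p, C)) in
    [/\ is_pfun f, card_lt (pdom f) [set: kappa], C `<=` pdom f `&` pran f &
        forall i, (0 < i <= size s)%N -> sigma (take i s) `<=` f].

Definition played (sigma : strategyII) (s : seq moveI) : set (kappa * kappa) :=
  \bigcup_(i in [set i | (0 < i <= size s)%N]) sigma (take i s).

(* On a well-founded tree every play is finite, so complete plays are the
   finite ones in which I is stuck. *)
Definition winningII (L : relational_language) (M N : Mod kappa L)
    (sigma : strategyII) : Prop :=
  legalII sigma /\
  forall s, completeI s -> partial_iso M N (played sigma s).

Definition EF_II_wins (L : relational_language) (M N : Mod kappa L) : Prop :=
  exists sigma : strategyII, winningII M N sigma.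
End Game.

(* Main.v *)
Require Import Defs.
From mathcomp Require Import all_boot all_order all_algebra.
From mathcomp Require Import finmap all_classical.
From mathcomp Require Import topology.

(* Put [W(s, f)] for the set of pairs [(M, N)] for which II wins the game
   continued from the moves [s] of I and the last answer [f] of II.  If I cannot
   move, membership in [W(s, f)] depends only on the restrictions of [M] and [N]
   to a bounded set (as [kappa] is regular), so [W(s, f)] is clopen; otherwise
   it is the intersection, over the at most [kappa] many moves [m] of I, of the
   unions, over the at most [kappa] many replies [g], of [W(sm, g)].  Such an
   alternation costs two Borel levels, so by induction on the rank [r] of the
   node last chosen by I, [W(s, f)] is [Pi0] of level [2 * r].  The isomorphism
   relation on [K] is [W] at the initial position, whose rank is [beta]. *)

Set Implicit Arguments.
Unset Strict Implicit.
Unset Printing Implicit Defensive.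

Import Order.TTheory.

Local Open Scope classical_set_scope.
Local Open Scope card_scope.

(** * Ordinals *)

Lemma ole_refl a : ole a a.
Proof. by elim: a => U f IH /= i; exists i. Qed.

Lemma ole_trans b a c : ole a b -> ole b c -> ole a c.
Proof.
elim: a b c => U f IH [V g] [W h] /= fg gh i.
have [j fgj] := fg i; have [k ghk] := gh j.
by exists k; exact: IH fgj ghk.
Qed.

(** The working form of [ole]: an ordinal is the least strict upper bound of its family, so bounding
    it means lying strictly above each member. *)
Lemma ole_below a b : ole a b <-> forall i : below a, olt (below_val i) b.
Proof.
by case: a b => U f [V g]; split => [fg i []|fg i]; [exact: fg|exact: (fg i tt)].
Qed.

Lemma ole_lower U (f : U -> ord) b :
  ole (osup f) b <-> forall i, olt (f i) b.
Proof. exact: ole_below. Qed.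

Lemma olt_below_val a (i : below a) : olt (below_val i) a.
Proof. by move: i; apply/ole_below/ole_refl. Qed.

Lemma olt_osup U (f : U -> ord) a i : ole a (f i) -> olt a (osup f).
Proof. by move=> afi []; exists i. Qed.

Lemma ole_osucc a : ole a (osucc a).
Proof.
elim: a => U f IH; apply/ole_lower => i []; exists tt.
by apply: ole_trans (IH i) _; apply/ole_lower => -[]; exact/olt_osup/ole_refl.
Qed.

Lemma olt_osucc a : olt a (osucc a).
Proof. exact: ole_refl. Qed.

Lemma ole_osucc2 a b : ole (osucc a) (osucc b) <-> ole a b.
Proof. by split=> [ab|ab []]; [have [[]] := ab tt|exists tt]. Qed.

Lemma ole_total a b : ole a b \/ olt b a.
Proof.
elim: a b => U f IH b; have [lefb|nlefb] := pselect (ole (osup f) b); first by left.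
(* For this [i], induction puts every member of the family of [b] strictly below [f i], so that [b]
   is at most [f i]. *)
right; have [i nfib] : exists i, ~ olt (f i) b.
  by apply: contrapT => /forallNP fb; apply/nlefb/ole_lower => i; exact: contrapT.
apply: (@olt_osup _ _ _ i).
case: b nfib {nlefb} => V g nfib; apply/ole_lower => j.
have [fg|//] := IH i (g j); by case: nfib; exact: olt_osup fg.
Qed.

(** A predecessor of [a] need not be a subterm of [a], only at most one. Hence accessibility is
    proved for all [b] with [ole b a], by structural induction on [a]. *)
Lemma olt_wf : well_founded olt.
Proof.
suff H a b : ole b a -> Acc olt b by move=> a; exact/H/ole_refl.
elim: a b => U f IH b ba; constructor => c cb.
have /(_ tt)[i ci] := ole_trans cb ba.
exact: IH ci.
Qed.

Lemma ole_min (P : ord -> Prop) a : P a ->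
  exists b, P b /\ forall c, P c -> ole b c.
Proof.
elim/(well_founded_ind olt_wf): a => a IH Pa.
have [aP|/existsNP[c /not_implyP[Pc ac]]] := pselect (forall c, P c -> ole a c).
  by exists a.
by apply: (IH c) => //; case: (ole_total a c).
Qed.

Lemma ole0 a : ole ozero a.
Proof. by case. Qed.

Lemma ole1_or0 a : oeq a ozero \/ ole oone a.
Proof.
have [a0|] := ole_total a ozero; last by right.
by left; split=> //; exact: ole0.
Qed.

Lemma not_ole10 : ~ ole oone ozero.
Proof. by move=> /(_ tt)[[]]. Qed.

(** * Suprema, sums and multiplication by 2 *)

Lemma olub_le J (h : J -> ord) a : ole (olub h) a <-> forall j, ole (h j) a.
Proof.
split=> [/ole_lower ha j|ha].
  by apply/ole_below => i; exact: (ha (existT _ j i)).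
by apply/ole_lower => -[j /=]; exact/ole_below.
Qed.

Lemma oadd0 a b : oeq b ozero -> oeq (oadd a b) a.
Proof.
case: b => V g [/ole_below g0 _]; split.
  apply/ole_lower => -[i|j]; last by have [[]] := g0 j tt.
  exact: olt_below_val.
by apply/ole_below => i; apply: (@olt_osup _ _ _ (inl i)); exact: ole_refl.
Qed.

(** The family of [oadd a (osucc b)] is that of [a] together with [oadd a b]; the hypothesis makes
    the last member dominate. *)
Lemma oadd_osucc a b : ole a (oadd a b) -> oeq (oadd a (osucc b)) (osucc (oadd a b)).
Proof.
move=> ab; split.
  apply/ole_lower => -[i|_] /=; last exact: olt_osucc.
  apply: ole_trans (ole_osucc _); apply: ole_trans ab.
  exact: olt_below_val.
by apply/ole_lower => _; apply: (@olt_osup _ _ _ (inr tt)); exact: ole_refl.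
Qed.

Lemma oadd2 a : oeq (oadd a otwo) (osucc (osucc a)).
Proof.
have [a0 a0'] := @oadd0 a ozero (conj (ole_refl _) (ole_refl _)).
have [a1 a1'] := oadd_osucc a0'.
have aa1 : ole a (oadd a oone).
  exact: ole_trans (ole_trans a0' (ole_osucc _)) a1'.
have [a2 a2'] := oadd_osucc aa1.
split.
  apply: (ole_trans a2); apply/ole_osucc2; apply: (ole_trans a1).
  exact/ole_osucc2.
apply: ole_trans a2'; apply/ole_osucc2; apply: ole_trans a1'.
exact/ole_osucc2.
Qed.

Lemma omul2_le a b :
  ole (omul otwo a) b <-> forall i : below a, ole (osucc (osucc (omul otwo (below_val i)))) b.
Proof.
case: a => U f; split=> [/olub_le fb i|fb].
  exact: ole_trans (oadd2 _).2 (fb i).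
by apply/olub_le => i; exact: ole_trans (oadd2 _).1 (fb i).
Qed.

Lemma omul2_mono a b : ole a b -> ole (omul otwo a) (omul otwo b).
Proof.
elim: a b => U f IH [V g] fg; apply/omul2_le => i.
have [j fgij] := fg i.
apply: ole_trans ((omul2_le (osup g) _).1 (ole_refl _) j).
exact/ole_osucc2/ole_osucc2/IH.
Qed.

(** One step down in rank leaves room for two Borel levels, one for a union and one for an
    intersection. *)
Lemma omul2_lt a b : olt a b -> ole (osucc (osucc (omul otwo a))) (omul otwo b).
Proof.
case: b => V g /(_ tt)[j agj].
apply: ole_trans ((omul2_le (osup g) _).1 (ole_refl _) j).
exact/ole_osucc2/ole_osucc2/omul2_mono.
Qed.

(** * Cardinal arithmetic under [kappa^{<kappa} = kappa] *)

(** Trades injections between subtypes for total functions; [u] is the default value outside [A]. *)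
Lemma inj_card_leP T U (A : set T) (B : set U) (u : U) :
  A #<= B <->
  exists f : T -> U, (forall x, A x -> B (f x)) /\ {in A &, injective f}.
Proof.
split=> [/card_leP[g]|[f [fB finj]]]; last first.
  have := inj_card_eq finj; rewrite card_eq_le => /andP[_ Af].
  apply: card_le_trans Af _; apply: subset_card_le; exact/image_subP.
pose f x := match pselect (A x) with
  | left Ax => set_val (g (SigSub (mem_set Ax))) | right _ => u end.
exists f; split=> [x Ax|x y /set_mem Ax /set_mem Ay]; rewrite /f.
  by case: pselect => // Ax'; exact: set_valP.
case: pselect => // Ax'; case: pselect => // Ay' /val_inj.
by move=> /(@inj _ _ _ g); rewrite !inE => /(_ I I) [].
Qed.

Lemma card_ltP T U (A : set T) (B : set U) :
  card_lt A B <-> (A #<= B) /\ ~ (B #<= A).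
Proof.
rewrite /card_lt; split=> [/andP[AB nAB]|[AB nBA]].
  by split=> // BA; rewrite card_eq_le AB BA in nAB.
by rewrite AB card_eq_le AB /=; exact/negP.
Qed.

Lemma card_le_lt_trans T U V (A : set T) (B : set U) (C : set V) :
  A #<= B -> card_lt B C -> card_lt A C.
Proof.
move=> AB /card_ltP[BC nCB]; apply/card_ltP; split.
  exact: card_le_trans AB BC.
by move=> CA; apply/nCB/(card_le_trans CA).
Qed.

Lemma card_lt_image_neqT T U (A : set T) (f : T -> U) :
  card_lt A [set: U] -> exists z, forall x, A x -> z <> f x.
Proof.
move=> /card_ltP[_ nUA]; apply: contrapT => /forallNP zN.
apply: nUA; apply: card_le_trans (card_image_le f A).
apply: subset_card_le => z _; apply: contrapT => zf.
by apply: (zN z) => x Ax zfx; apply: zf; exists x.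
Qed.

Section InfiniteCardinal.
Context d (kappa : orderType d).
Hypothesis kappa_card : is_cardinal kappa.
Hypothesis kappa_infinite : infinite_set [set: kappa].

Lemma cardinal_min (A : set kappa) : A !=set0 ->
  exists z, A z /\ forall x, A x -> (z <= x)%O.
Proof.
move=> [x Ax]; have [|z [[/set_mem Az zA] _]] := @cardinal_wo _ _ kappa_card (mem A).
  by exists x; exact: mem_set.
by exists z; split=> // y Ay; exact/zA/mem_set.
Qed.

Lemma cardinal_lt_wf : well_founded (fun x y : kappa => (x < y)%O).
Proof.
move=> x; apply: contrapT => nx.
have [z [nz zmin]] : exists z, ~ Acc (fun x y : kappa => (x < y)%O) z /\
    forall x, ~ Acc (fun x y : kappa => (x < y)%O) x -> (z <= x)%O.
  by apply: cardinal_min; exists x.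
apply: nz; constructor => y yz; apply: contrapT => /zmin.
by rewrite leNgt yz.
Qed.

Lemma cardinal_inhabited : exists x : kappa, True.
Proof. by have [x _] := infinite_setN0 kappa_infinite; exists x. Qed.

(* Hilbert's hotel: [kappa] injects into [kappa] minus a point. *)
Lemma cardinal_no_max (m : kappa) : exists x, (m < x)%O.
Proof.
apply: contrapT => /forallNP mmax.
have /card_ltP[_] := cardinal_initial kappa_card m; apply.
have : infinite_set [set~ m].
  by rewrite -setTD; apply: infinite_setD => //; exact: finite_set1.
move=> /infiniteP /(inj_card_leP _ _ m).1[f [fm finj]].
have f_inj : injective f by move=> i j; apply: finj; exact: mem_set.
(* [g] sends [m] to [f 0], shifts the sequence [f] by one and fixes all other points. It avoids the
   maximum [m], so it injects [kappa] into the initial segment below [m]. *)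
pose g x := if x == m then f 0%N else
  match pselect (exists n, x = f n) with
  | left e => f (projT1 (cid e)).+1 | right _ => x end.
apply/(inj_card_leP _ _ m); exists g; split=> [x _|x y _ _].
  suff : g x <> m.
    by move/eqP => gm; rewrite /= lt_neqAle gm leNgt; exact/negP.
  rewrite /g; case: eqP => [_|xm]; first exact: fm.
  by case: pselect => // e; exact: fm.
rewrite /g; case: eqP => [->|_]; case: eqP => [->|_] //.
- case: pselect => [e /f_inj//|ny e]; by case: ny; exists 0%N.
- case: pselect => [e /f_inj//|nx e]; by case: nx; exists 0%N.
case: pselect => [ex|nx]; case: pselect => [ey|ny] //.
- case: (cid ex) => i xi; case: (cid ey) => j yj /= /f_inj[ij].
  by rewrite xi yj ij.
- by move=> e; case: ny; eexists; rewrite -e.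
- by move=> e; case: nx; eexists; rewrite e.
Qed.

Lemma bounded_card_lt (D : set kappa) : bounded_in D -> card_lt D [set: kappa].
Proof.
move=> [a Da]; apply: card_le_lt_trans (cardinal_initial kappa_card a).
exact: subset_card_le.
Qed.

(* The transitive collapse of [D]. *)
Lemma card_lt_collapse (D : set kappa) : card_lt D [set: kappa] ->
  exists (a : kappa) (c : kappa -> kappa),
    (forall x, D x -> (c x < a)%O) /\ {in D &, injective c}.
Proof.
move=> Dlt; have [k0 _] := cardinal_inhabited.
(* [mex A] is the least element of [A], with an arbitrary value when [A] is empty. *)
have /choice[mex mexP] : forall A : set kappa, exists z, A !=set0 ->
    A z /\ forall x, A x -> (z <= x)%O.
  move=> A; have [/cardinal_min[z zP]|nA] := pselect (A !=set0); last by exists k0.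
  by exists z.
pose step x (rec : forall y, (y < x)%O -> kappa) :=
  mex [set z | forall y (yx : (y < x)%O), D y -> z <> rec y yx].
pose c := Fix cardinal_lt_wf (fun=> kappa) step.
have cE x : c x = mex [set z | forall y, (y < x)%O -> D y -> z <> c y].
  rewrite /c Fix_eq //= => {}x f g fg; congr mex; apply/seteqP.
  by split=> z zP y yx Dy; have := zP y yx Dy; rewrite fg.
have cP x : (forall y, (y < x)%O -> D y -> c x <> c y) /\
    forall z, (z < c x)%O -> exists2 y, D y & z = c y.
  have [|cx cmin] := mexP [set z | forall y, (y < x)%O -> D y -> z <> c y].
    have [z zP] := card_lt_image_neqT c Dlt.
    by exists z => y _; exact: zP.
  rewrite cE; split=> // z; rewrite ltNge => /negP zlt.
  apply: contrapT => nz; apply: zlt; apply: cmin => y _ Dy zy.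
  by apply: nz; exists y.
(* The values of [c] on [D] are closed downwards, so a value [z] that [c] misses on [D] lies above
   all of them. *)
have [z zc] := card_lt_image_neqT c Dlt.
exists z, c; split=> [x Dx|x y /set_mem Dx /set_mem Dy cxy].
  case: (ltgtP (c x) z) => // [|/esym/zc//].
  by move=> /(cP x).2[y Dy /zc].
case: (ltgtP x y) => // [xy|yx].
  by have /(_ (esym cxy)) := (cP y).1 x xy Dx.
by have /(_ cxy) := (cP x).1 y yx Dy.
Qed.

Hypothesis kappa_pow : kappa_lt_kappa kappa.

(** Beyond its length a sequence is read as the identity, a default value that makes it total. *)
Definition seq_at (s : seq_below kappa) (x : kappa) : kappa :=
  let: existT a f := s in
  match pselect ([set x | (x < a)%O] x) with
  | left xa => f (SigSub (mem_set xa)) | right _ => x end.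

Lemma seq_atE a (f : kappa -> kappa) x : (x < a)%O ->
  seq_at (existT _ a (fun z => f (set_val z))) x = f x.
Proof. by move=> xa /=; case: pselect. Qed.

(* Koenig: diagonalize an enumeration of the functions from the order type
   of [D], along [D], to [kappa]. *)
Lemma card_lt_bounded (D : set kappa) :
  card_lt D [set: kappa] <-> bounded_in D.
Proof.
split; last exact: bounded_card_lt.
move=> Dlt; apply: contrapT => /forallNP Dunb.
have [k0 _] := cardinal_inhabited.
have [a [c [ca c_inj]]] := card_lt_collapse Dlt.
have [h [_ h_inj]] : exists h : seq_below kappa -> kappa,
    (forall x, [set: seq_below kappa] x -> [set: kappa] (h x)) /\
    {in [set: seq_below kappa] &, injective h}.
  apply/(inj_card_leP _ _ k0); have := kappa_pow; rewrite /kappa_lt_kappa.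
  by rewrite card_eq_le => /andP[].
(* Fewer than [kappa] many sequences have a code at most [y], so some [v y] differs from all their
   values at [c y]. *)
have /choice[v vP] y : exists v, forall s, (h s <= y)%O -> v <> seq_at s (c y).
  have [y' yy'] := cardinal_no_max y.
  have /card_lt_image_neqT P : card_lt [set s | (h s <= y)%O] [set: kappa].
    apply: card_le_lt_trans (cardinal_initial kappa_card y').
    apply/(inj_card_leP _ _ k0); exists h; split=> [s /= sy|s t _ _].
      exact: le_lt_trans sy yy'.
    by apply: h_inj; exact: mem_set.
  have [z zP] := P (fun s => seq_at s (c y)).
  by exists z.
have /choice[b bP] x : exists y, forall y', D y' -> c y' = x -> y' = y.
  have [[y Dy cy]|nx] := pselect (exists2 y, D y & c y = x); last first.
    by exists k0 => y Dy cy; case: nx; exists y.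
  exists y => y' Dy' cy'; apply: c_inj; rewrite ?cy//; exact: mem_set.
(* With [b] inverting [c] on [D], the diagonal sequence [s] takes the value [v y] at [c y]. An
   unbounded [D] contains some [y] at or above the code of [s], where [v y] must differ from that
   value. *)
pose s : seq_below kappa := existT _ a (fun z => v (b (set_val z))).
have /existsNP[y /not_implyP[Dy /negP]] := Dunb (h s).
rewrite -leNgt => /vP; apply.
rewrite (@seq_atE a (v \o b)) /=; last exact: ca.
by rewrite -(bP (c y) y).
Qed.

Lemma card_le_seq_image T (A : set T) (f : seq_below kappa -> T) :
  (forall x, A x -> exists s, f s = x) -> A #<= [set: kappa].
Proof.
move=> fA; have := kappa_pow; rewrite /kappa_lt_kappa.
rewrite card_eq_le => /andP[kle _]; apply: card_le_trans kle.
apply: card_le_trans (card_image_le f _); apply: subset_card_le => x.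
by move=> /fA[s <-]; exists s.
Qed.

Lemma cardinal_two : exists x y : kappa, x != y.
Proof.
have [x _] := cardinal_inhabited; have [y xy] := cardinal_no_max x.
by exists x, y; rewrite lt_eqF.
Qed.

(** A small set is bounded, so its characteristic function, with values [x] and [y], is coded by a
    sequence of length below [kappa]. *)
Lemma card_le_small_sets :
  [set C : set kappa | card_lt C [set: kappa]] #<= [set: kappa].
Proof.
have [x [y xy]] := cardinal_two.
apply: (@card_le_seq_image _ _
  (fun s => [set z | (z < projT1 s)%O /\ seq_at s z = y])) => C.
move=> /card_lt_bounded[a Ca].
pose f z := if z \in C then y else x.
exists (existT _ a (fun z => f (set_val z))).
apply/seteqP; split=> z.
  move=> [za]; rewrite seq_atE// /f; case: ifP => [/set_mem//|_ exy].
  by rewrite exy eqxx in xy.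
move=> Cz; split; first exact: Ca.
by rewrite seq_atE ?Ca// /f mem_set.
Qed.

Lemma card_le_squareT : [set: kappa * kappa] #<= [set: kappa].
Proof.
have [x [y xy]] := cardinal_two.
have [a xya] := cardinal_no_max (Order.max x y).
apply: (@card_le_seq_image _ _ (fun s => (seq_at s x, seq_at s y))) => -[u v] _.
pose f z := if z == x then u else v.
exists (existT _ a (fun z => f (set_val z))); move: xya; rewrite gt_max => /andP[xa ya].
by rewrite !seq_atE// /f eqxx eq_sym (negbTE xy).
Qed.

Lemma card_le_setX T U (A : set T) (B : set U) :
  A #<= [set: kappa] -> B #<= [set: kappa] -> A `*` B #<= [set: kappa].
Proof.
have [k0 _] := cardinal_inhabited.
move=> /(inj_card_leP _ _ k0)[f [_ f_inj]] /(inj_card_leP _ _ k0)[g [_ g_inj]].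
apply: card_le_trans card_le_squareT; apply/(inj_card_leP _ _ (k0, k0)).
exists (fun z => (f z.1, g z.2)); split=> // -[x y] [x' y'].
move=> /set_mem[/= Ax By] /set_mem[/= Ax' By'] [fx gy].
by congr pair; [apply: f_inj|apply: g_inj] => //; exact: mem_set.
Qed.

Lemma is_pfun_card_lt (g : set (kappa * kappa)) : is_pfun g ->
  card_lt (pdom g) [set: kappa] -> card_lt g [set: kappa] /\ card_lt (pran g) [set: kappa].
Proof.
move=> gfun glt; have glt' : card_lt g [set: kappa].
  apply: card_le_lt_trans glt; have [k0 _] := cardinal_inhabited.
  apply/(inj_card_leP _ _ k0); exists fst; split=> [x gx|]; first by exists x.
  move=> [x y] [x' y'] /set_mem gx /set_mem gy /= xx'.
  by rewrite xx' in gx *; rewrite (gfun _ _ _ gx gy).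
by split=> //; apply: card_le_lt_trans glt'; exact: card_image_le.
Qed.

(** An injective pairing function [p] turns the graph of a small partial function into a small
    subset of [kappa]. *)
Lemma card_le_small_pfuns :
  [set g : set (kappa * kappa) | is_pfun g /\ card_lt (pdom g) [set: kappa]]
    #<= [set: kappa].
Proof.
have [k0 _] := cardinal_inhabited.
have /(inj_card_leP _ _ k0)[p [_ p_inj]] := card_le_squareT.
apply: card_le_trans card_le_small_sets.
apply/(inj_card_leP _ _ set0); exists (fun g => p @` g); split.
  move=> g [gfun /(is_pfun_card_lt gfun)[glt _]] /=.
  exact: card_le_lt_trans (card_image_le _ _) glt.
have {}p_inj : injective p by move=> x y; apply: p_inj; exact: mem_set.
by move=> g g' _ _ gg'; apply/funext => x; rewrite -(image_inj p_inj) gg' image_inj.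
Qed.

End InfiniteCardinal.

(** * Positions of the Ehrenfeucht-Fraisse game *)

Section WinningPositions.
Context d (kappa : orderType d) d' (T : porderType d') (root : T).
Context (L : relational_language) (M N : Mod kappa L).

Definition position (s : seq (moveI kappa T)) : T := last root [seq m.1 | m <- s].

Lemma legalI_rcons (s : seq (moveI kappa T)) m : legalI root (rcons s m) ->
  legalI root s /\ (position s < m.1)%O.
Proof.
rewrite /legalI !map_rcons rcons_path all_rcons pairwise_rcons /position.
by move=> /and3P[/andP[-> /andP[-> _]] /andP[_ ->] /andP[_ ->]].
Qed.

Lemma legalI_rcons_small (s : seq (moveI kappa T)) p C :
  legalI root (rcons s (p, C)) -> card_lt C [set: kappa].
Proof. by rewrite /legalI all_rcons => /and3P[_ /andP[]]. Qed.

(** Only the last answer [f] has to be extended; earlier ones are included by transitivity. *)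
Definition reply (f : set (kappa * kappa)) (C : set kappa)
    (g : set (kappa * kappa)) : Prop :=
  [/\ is_pfun g, card_lt (pdom g) [set: kappa], C `<=` pdom g `&` pran g & f `<=` g].

(* The value of the position reached after the moves [s] of I, when [f] is the
   last answer of II, or the empty function if there was none. *)
Inductive II_wins_from : seq (moveI kappa T) -> set (kappa * kappa) -> Prop :=
| II_wins_from_intro s f :
    (completeI root s -> partial_iso M N f) ->
    (forall m, legalI root (rcons s m) ->
       exists g, reply f m.2 g /\ II_wins_from (rcons s m) g) ->
    II_wins_from s f.

Lemma II_wins_fromE s f : II_wins_from s f <->
  (completeI root s -> partial_iso M N f) /\
  (forall m, legalI root (rcons s m) ->
     exists g, reply f m.2 g /\ II_wins_from (rcons s m) g).
Proof. by split=> [[]|[]]. Qed.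

Lemma played_last (sigma : strategyII kappa T) s :
  (forall i, (0 < i <= size s)%N -> sigma (take i s) `<=` sigma s) ->
  played sigma s = if s is [::] then set0 else sigma s.
Proof.
move=> mono; apply/seteqP; split=> [x [i /= si]|].
  by move=> /(mono _ si); case: s si mono => // /andP[/leq_trans/[apply]].
case: s mono => [_ x []|m s _ x mx]; exists (size (m :: s)); first by rewrite /= leqnn.
by rewrite take_size.
Qed.

(** Each move of I goes strictly up in the tree, so induction on the current node, from the top
    down, applies. The case distinction replaces the meaningless value of [sigma] at the empty
    sequence by the empty function. *)
Lemma winning_II_wins_from (wf : tree_wf T) sigma s :
  winningII root M N sigma -> legalI root s ->
  II_wins_from s (if s is [::] then set0 else sigma s).
Proof.
move=> [leg win]; move: {2}(position s) (erefl (position s)) => p.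
elim/(well_founded_ind (tree_wf_gt wf)): p s => p IH s ps ls.
apply/II_wins_fromE; split=> [cs|[q C] lm].
  rewrite -played_last; first exact: win.
  case/lastP: s ls {ps cs} => [|s [q C]] ls i; first by case: i.
  move=> /andP[i0]; rewrite leq_eqVlt => /orP[/eqP->|]; first by rewrite take_size.
  rewrite size_rcons ltnS => le_is.
  have [_ _ _] := leg _ _ _ ls; rewrite -cats1 takel_cat//; apply.
  by rewrite i0.
exists (sigma (rcons s (q, C))); have [? ? ? mono] := leg _ _ _ lm.
split.
  split=> //; move: mono; case: (s) => [_ x []|m s' mono].
  by have := mono (size (m :: s')); rewrite take_size leqnn; exact.
have [_ pq] := legalI_rcons lm.
have := IH q _ (rcons s (q, C)) _ lm; rewrite -ps => /(_ pq).
rewrite /position map_rcons last_rcons => /(_ erefl).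
by case: (s).
Qed.

Lemma EF_II_winsP (wf : tree_wf T) :
  EF_II_wins root M N <-> II_wins_from [::] set0.
Proof.
(* For the converse, [resp] chooses a good reply wherever one exists, and the strategy follows these
   choices. *)
split=> [[sigma win]|win0]; first exact: (winning_II_wins_from wf win).
have /choice[resp respP] t : exists g,
    (exists h, reply t.1.2 t.2.2 h /\ II_wins_from (rcons t.1.1 t.2) h) ->
    reply t.1.2 t.2.2 g /\ II_wins_from (rcons t.1.1 t.2) g.
  have [[h hP]|nh] :=
    pselect (exists h, reply t.1.2 t.2.2 h /\ II_wins_from (rcons t.1.1 t.2) h).
    by exists h.
  by exists set0.
(* The chosen reply depends on the moves so far and on the current answer, so [play] rebuilds both
   from the moves of I. *)
pose play := foldl (fun t m => (rcons t.1 m, resp (t, m))) ([::], set0).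
pose sigma : strategyII kappa T := fun s => (play s).2.
have sigmaE s m : sigma (rcons s m) = resp ((s, sigma s), m).
  have play1 s' : (play s').1 = s'.
    by elim/last_ind: s' => // s' m'; rewrite /play foldl_rcons /= => ->.
  have pairE : play s = (s, sigma s).
    by rewrite /sigma; case: (play s) (play1 s) => s' f /= ->.
  by rewrite {1}/sigma /play foldl_rcons -/(play s) pairE.
have wins s : legalI root s -> II_wins_from s (sigma s).
  elim/last_ind: s => // s m IH lm; have [ls _] := legalI_rcons lm.
  have /II_wins_fromE[_ /(_ _ lm) /(respP ((s, sigma s), m))[_]] := IH ls.
  by rewrite sigmaE.
have replies s m : legalI root (rcons s m) ->
    reply (sigma s) m.2 (sigma (rcons s m)).
  move=> lm; have [/wins ws _] := legalI_rcons lm.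
  have /II_wins_fromE[_ /(_ _ lm) /(respP ((s, sigma s), m))[+ _]] := ws.
  by rewrite sigmaE.
have mono s i : legalI root s -> (i <= size s)%N -> sigma (take i s) `<=` sigma s.
  elim/last_ind: s => [_|s m IH lm]; first by rewrite leqn0 => /eqP->.
  have [ls _] := legalI_rcons lm.
  rewrite leq_eqVlt => /orP[/eqP->|]; first by rewrite take_size.
  rewrite size_rcons ltnS => le_is.
  rewrite -cats1 takel_cat// cats1 => x smx; have [_ _ _] := replies _ _ lm.
  by apply; exact: IH smx.
exists sigma; split=> [s p C lm|s cs] /=.
  have [? ? ? sub] := replies _ _ lm; have [ls _] := legalI_rcons lm.
  split=> // i /andP[_ le_is] x smx; exact/sub/(mono _ i).
have [ls _] := cs; have /II_wins_fromE[/(_ cs) + _] := wins _ ls.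
rewrite played_last; last by move=> i /andP[_]; exact: mono.
by case: (s).
Qed.

End WinningPositions.

(** * Borel classes and the bounded topology *)

Section BorelHierarchy.
Context (kappa : Type) (X : topologicalType).
Implicit Types (a b : ord) (A : set X).

Lemma Sigma0_oeq a b A : oeq a b -> Sigma0 kappa a A -> Sigma0 kappa b A.
Proof.
move=> [ab ba] [[a1 a1'] Aopen|F g a2 gP FP AE].
  by apply: Sigma0_open => //; split; [exact: ole_trans ba a1|exact: ole_trans a1' ab].
apply: (Sigma0_union (F := F) (g := g)) => //; first exact: ole_trans a2 ab.
by move=> i; have [g1 ga] := gP i; split=> //; exact: ole_trans ga ab.
Qed.

Lemma Pi0_oeq a b A : oeq a b -> Pi0 kappa a A -> Pi0 kappa b A.
Proof.
move=> /[dup] ab [aleb blea] [[[a0 a0'] Acl]|[a1 AS]].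
  by left; split=> //; split; [exact: ole_trans blea a0|exact: ole0].
by right; split; [exact: ole_trans a1 aleb|exact: Sigma0_oeq AS].
Qed.

(** An injection [e] of [J] into [kappa] reindexes the union. Indices outside its image receive the
    empty set at level 1, which is below [a]. *)
Lemma Sigma0_bigcup (I : Type) (J : set I) (F : I -> set X) (g : I -> ord) a :
  inhabited kappa -> J #<= [set: kappa] -> ole otwo a ->
  (forall i, J i -> [/\ ole oone (g i), olt (g i) a & Sigma0 kappa (g i) (~` F i)]) ->
  Sigma0 kappa a (\bigcup_(i in J) F i).
Proof.
move=> [k0] /(inj_card_leP _ _ k0)[e [_ e_inj]] a2 FP.
have /choice[G GP] k : exists G : set X * ord,
    [/\ ole oone G.2, olt G.2 a, Sigma0 kappa G.2 (~` G.1) &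
        (forall i, J i -> e i = k -> G.1 = F i) /\
        ((forall i, J i -> e i <> k) -> G.1 = set0)].
  have [[i Ji eik]|nk] := pselect (exists2 i, J i & e i = k).
    have [g1 ga FS] := FP i Ji; exists (F i, g i); split=> //; split.
      move=> j Jj ejk; congr F; apply: e_inj; rewrite ?inE//.
      by rewrite ejk.
    by move=> /(_ i Ji).
  exists (set0, oone); split.
  - exact: ole_refl.
  - exact: a2.
  - by rewrite setC0; apply: Sigma0_open; [split; exact: ole_refl|exact: openT].
  - by split=> // i Ji eik; case: nk; exists i.
apply: (Sigma0_union (F := fun k => (G k).1) (g := fun k => (G k).2)) => //.
- by move=> k; have [] := GP k.
- by move=> k; have [] := GP k.
apply/seteqP; split=> x.
  move=> [i Ji Fix]; exists (e i) => //.
  by have [_ _ _ [GF _]] := GP (e i); rewrite (GF i).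
move=> [k _]; have [_ _ _ [Gk Gk0]] := GP k.
have [[i Ji eik]|nk] := pselect (exists2 i, J i & e i = k).
  by rewrite (Gk i Ji eik); exists i.
by rewrite Gk0// => i Ji eik; apply: nk; exists i.
Qed.

(** A closed set is the union of [kappa] many copies of itself, each with an open complement. *)
Lemma closed_Sigma0 a A : inhabited kappa -> ole otwo a -> closed A ->
  Sigma0 kappa a A.
Proof.
move=> [k] a2 Acl; have -> : A = \bigcup_(_ in [set: kappa]) A.
  by rewrite bigcup_const//; exists k.
apply: (@Sigma0_bigcup _ _ _ (fun=> oone)) => // _ _; split=> //.
  exact: ole_refl.
by apply: Sigma0_open; [split; exact: ole_refl|exact: closed_openC].
Qed.

Lemma Pi0_rkB a A : Pi0 kappa a A -> exists b, rkB kappa A b /\ ole b a.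
Proof.
have [Acl _|nAcl] := pselect (clopen A).
  exists ozero; split; last exact: ole0.
  by left; split=> //; split; exact: ole_refl.
move=> [[_ //]|[a1 AS]].
have aP : Sigma0_or_Pi0 kappa a A by split=> //; right; right.
have [b [bP bmin]] := @ole_min (fun b => Sigma0_or_Pi0 kappa b A) a aP.
by exists b; split; [right|exact: bmin].
Qed.

End BorelHierarchy.

(** * Clopen conditions on bounded parts of structures *)

Section StructureTopology.
Context d (kappa : orderType d) (L : relational_language).

Definition agree_on (D : set kappa) (M N : Mod kappa L) : Prop :=
  forall (R : L) (a : 'I_(arity R) -> kappa), (forall i, D (a i)) -> (M R a <-> N R a).

Lemma open_Mod_basic (U : set (Mod kappa L)) : Mod_basic U -> open U.
Proof.
move=> UB; exists [set U]; last by rewrite bigcup_set1.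
move=> _ ->; exists [fset U]%fset; last by rewrite set_fset1 bigcap_set1.
by move=> V /fset1P->; exact: mem_set.
Qed.

(** The basic set given by the substructure of [M] on [D] consists of structures agreeing with [M]
    there. *)
Lemma nbhs_agree_on (D : set kappa) (M : Mod kappa L) :
  bounded_in D -> nbhs M (agree_on D M).
Proof.
move=> Db; pose Q : structure L D := fun R a => M R (set_val \o a).
have Uopen : open [set N : Mod kappa L | substructure Q N].
  by apply: open_Mod_basic; exists D, Q.
have : nbhs M [set N : Mod kappa L | substructure Q N] by apply: open_nbhs_nbhs.
apply: filterS => N QN R a Da.
pose a' i : D := SigSub (mem_set (Da i)).
by have := QN R a'; rewrite /Q (_ : set_val \o a' = a).
Qed.

Context (K : set (Mod kappa L)).

(** Pairs agreeing with a given one on [D] form a neighbourhood of it, so [A] is open; since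
    agreement is symmetric, the complement is open as well. *)
Lemma clopen_agree_on (D : set kappa) (A : set (square K)) : bounded_in D ->
  (forall x y : square K, agree_on D (set_val x.1) (set_val y.1) ->
     agree_on D (set_val x.2) (set_val y.2) -> A x -> A y) ->
  clopen A.
Proof.
move=> Db Aagree.
have near_agree (x : square K) : nbhs x
    [set y : square K | agree_on D (set_val x.1) (set_val y.1) /\
                        agree_on D (set_val x.2) (set_val y.2)].
  exists ([set M : set_type K | agree_on D (set_val x.1) (set_val M)],
          [set M : set_type K | agree_on D (set_val x.2) (set_val M)]) => //.
  by split; apply: initial_continuous; exact: nbhs_agree_on.
have agree_sym M N : agree_on D M N -> agree_on D N M.
  by move=> MN R a /MN ->.
have Aopen : open A.
  by rewrite openE => x Ax; apply: filterS (near_agree x) => y [xy1 xy2]; exact: Aagree Ax.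
split=> //; rewrite -openC openE => x nAx; apply: filterS (near_agree x).
by move=> y [xy1 xy2] Ay; apply: nAx; apply: Aagree Ay; exact: agree_sym.
Qed.

Lemma clopen_partial_iso (D : set kappa) (f : set (kappa * kappa)) : bounded_in D ->
  pdom f `<=` D -> pran f `<=` D ->
  clopen [set x : square K | partial_iso (set_val x.1) (set_val x.2) f].
Proof.
move=> Db fD fD'; apply: (clopen_agree_on Db) => x y xy1 xy2 [f1 f2 iso].
split=> // R a b fab; rewrite -xy1 -?xy2; first exact: iso.
  by move=> i; apply: fD'; exists (a i, b i).
by move=> i; apply: fD; exists (a i, b i).
Qed.

End StructureTopology.

(** * Complexity of the winning positions *)

Lemma node_rankE d (T : porderType d) (wf : tree_wf T) p :
  node_rank wf p = osup (fun q : {q : T | (p < q)%O} => node_rank wf (sval q)).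
Proof.
rewrite /node_rank Fix_eq // => {}p f g fg; congr osup.
by apply/funext => q; exact: fg.
Qed.

Section Complexity.
Context d (kappa : orderType d).
Hypothesis kappa_card : is_cardinal kappa.
Hypothesis kappa_infinite : infinite_set [set: kappa].
Hypothesis kappa_pow : kappa_lt_kappa kappa.
Context (L : relational_language) (K : set (Mod kappa L)).
Context d' (T : porderType d') (root : T).
Hypothesis T_wf : tree_wf T.
Hypothesis T_size : [set: T] #<= [set: kappa].

Let win (s : seq (moveI kappa T)) (f : set (kappa * kappa)) : set (square K) :=
  [set x | II_wins_from root (set_val x.1) (set_val x.2) s f].

Lemma clopen_partial_iso_small (f : set (kappa * kappa)) :
  is_pfun f -> card_lt (pdom f) [set: kappa] ->
  clopen [set x : square K | partial_iso (set_val x.1) (set_val x.2) f].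
Proof.
move=> ffun flt; have [_] := is_pfun_card_lt kappa_infinite ffun flt.
move=> /(card_lt_bounded kappa_card kappa_infinite kappa_pow)[b fb].
move: flt => /(card_lt_bounded kappa_card kappa_infinite kappa_pow)[a fa].
apply: (@clopen_partial_iso _ _ _ _ [set x | (x < Order.max a b)%O]).
- by exists (Order.max a b).
- by move=> x /fa xa; rewrite /= lt_max xa.
- by move=> x /fb xb; rewrite /= lt_max xb orbT.
Qed.

Lemma win_Pi0 s f : legalI root s -> is_pfun f -> card_lt (pdom f) [set: kappa] ->
  Pi0 kappa (omul otwo (node_rank T_wf (position root s))) (win s f).
Proof.
have kappa_inh : inhabited kappa by have [k _] := cardinal_inhabited kappa_infinite.
move: {2}(position root s) (erefl (position root s)) => p.
elim/(well_founded_ind (tree_wf_gt T_wf)): p s f => p IH s f ps ls ffun flt.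
rewrite ps; set r := node_rank T_wf.
have lt2 q : (p < q)%O -> ole (osucc (osucc (omul otwo (r q)))) (omul otwo (r p)).
  move=> pq; apply: omul2_lt; rewrite /r (node_rankE _ p).
  by apply: (@olt_osup _ _ _ (exist _ q pq)); exact: ole_refl.
have le2 q : (p < q)%O -> ole otwo (omul otwo (r p)).
  by move=> /lt2; apply: ole_trans; exact/ole_osucc2/ole_osucc2/ole0.
have [[m lm]|nm] := pselect (exists m, legalI root (rcons s m)); last first.
  have -> : win s f = [set x : square K | partial_iso (set_val x.1) (set_val x.2) f].
    apply/seteqP; split=> x /=; rewrite /win /= II_wins_fromE.
      by move=> [+ _]; apply; split=> // m lm; apply: nm; exists m.
    by move=> iso; split=> // m lm; case: nm; exists m.
  have fcl := clopen_partial_iso_small ffun flt.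
  (* If nothing lies above [p], the level is 0, where [Pi0] means clopen. Otherwise the level is at
     least 2, and the complement, being closed, is [Sigma0] there. *)
  have [[q pq]|leaf] := pselect (exists q, (p < q)%O).
    right; split; first exact: ole_trans (ole_osucc _) (le2 q pq).
    apply: closed_Sigma0 => //; first exact: le2 pq.
    by case: fcl => fo _; exact: open_closedC.
  left; split=> //; split; last exact: ole0.
  apply/omul2_le; rewrite /r node_rankE => -[q pq].
  by case: leaf; exists q.
have pm n : legalI root (rcons s n) -> (p < n.1)%O.
  by move=> /legalI_rcons[_]; rewrite ps.
(* The intersection over moves is written as the complement of a union. Since I has the move [m],
   the condition on complete plays is vacuous. *)
have -> : win s f = ~` \bigcup_(n in [set n | legalI root (rcons s n)])
    ~` \bigcup_(g in reply f n.2) win (rcons s n) g.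
  rewrite setC_bigcup; apply/seteqP; split=> x.
    move=> /II_wins_fromE[_ xwin] n ln; rewrite setCK.
    by have [g [fg gwin]] := xwin n ln; exists g.
  move=> xwin; apply/II_wins_fromE; split=> [[_ /(_ m)]//|n ln].
  by have := xwin n ln; rewrite setCK => -[g fg gwin]; exists g.
right; split; first exact: ole_trans (ole_osucc _) (le2 _ (pm _ lm)).
(* The union over replies sits one level above twice the rank of the new node, and the intersection
   over moves one level higher, which is at most twice the rank of [p]. *)
rewrite setCK; apply: (Sigma0_bigcup (g := fun n => osucc (omul otwo (r n.1)))).
- exact: kappa_inh.
- have [k _] := cardinal_inhabited kappa_infinite.
  apply: card_le_trans (card_le_setX kappa_card kappa_infinite kappa_pow T_size
    (card_le_small_sets kappa_card kappa_infinite kappa_pow)).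
  by apply: subset_card_le => -[q C] /legalI_rcons_small.
- exact: le2 (pm _ lm).
move=> n ln; split; [exact/ole_osucc2/ole0|exact/lt2/pm|rewrite setCK].
have gPi0 g : reply f n.2 g -> Pi0 kappa (omul otwo (r n.1)) (win (rcons s n) g).
  have posn : position root (rcons s n) = n.1.
    by rewrite /position map_rcons last_rcons.
  move=> [gfun glt _ _]; rewrite -posn.
  exact: IH (pm _ ln) _ _ posn ln gfun glt.
(* At level 0 the sets for the replies are clopen, so their union is open, of level 1. Otherwise the
   successor level is at least 2, as [Sigma0_bigcup] requires. *)
have [r0|r1] := ole1_or0 (omul otwo (r n.1)).
  apply: Sigma0_open.
    by case: r0 => r0 r0'; split; apply/ole_osucc2.
  apply: bigcup_open => g /gPi0[[_ []//]|[r1 _]].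
  by case: not_ole10; exact: ole_trans r1 r0.1.
apply: (Sigma0_bigcup (g := fun=> omul otwo (r n.1))) => //.
- have := card_le_small_pfuns kappa_card kappa_infinite kappa_pow.
  by apply: card_le_trans; apply: subset_card_le => g [].
move=> g /gPi0[[r0 _]|[_ gS]]; last by split=> //; exact: olt_osucc.
by case: not_ole10; exact: ole_trans r1 r0.1.
Qed.

End Complexity.

(** * Borel complexity of the isomorphism relation *)

Theorem theorem4p9 (d : Order.disp_t) (kappa : orderType d)
    (kappa_card : is_cardinal kappa)
    (kappa_infinite : infinite_set [set: kappa])
    (kappa_pow : kappa_lt_kappa kappa)
    (L : relational_language)
    (L_small : card_lt [set: L] [set: kappa])
    (K : set (Mod kappa L)) (K_inv : invariant_set K)
    (d' : Order.disp_t) (Tr : porderType d') (root : Tr)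
    (Tr_tree : is_tree root) (Tr_wf : tree_wf Tr)
    (Tr_size : [set: Tr] #<= [set: kappa])
    (beta : ord) (Tr_rank : oeq (tree_rank Tr_wf root) (osucc beta))
    (K_EF : forall M N : Mod kappa L, K M -> K N ->
       (isomorphic M N <-> EF_II_wins root M N)) :
  @Pi0 kappa (square K) (omul otwo beta) (iso_rel K) /\
  exists a : ord, @rkB kappa (square K) (iso_rel K) a /\ ole a (omul otwo beta).
Proof.
suff isoPi0 : Pi0 kappa (omul otwo beta) (iso_rel K).
  by split=> //; exact: Pi0_rkB.
have -> : iso_rel K = [set x : square K |
    II_wins_from root (set_val x.1) (set_val x.2) [::] set0].
  apply/seteqP; split=> -[[M KM] [N KN]] /=; rewrite /iso_rel /=.
    by move=> /(K_EF M N (set_mem KM) (set_mem KN))/(EF_II_winsP _ _ _ Tr_wf).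
  by move=> /(EF_II_winsP _ _ _ Tr_wf)/(K_EF M N (set_mem KM) (set_mem KN)).
(* The rank of the tree is the rank of its root plus one, which cancels against the successor of
   [beta]. *)
have rank_beta : oeq (node_rank Tr_wf root) beta.
  by case: Tr_rank => /ole_osucc2 ? /ole_osucc2.
apply: Pi0_oeq (win_Pi0 kappa_card kappa_infinite kappa_pow K Tr_wf Tr_size
  (s := [::]) (f := set0) _ _ _) => //.
- by case: rank_beta => *; split; exact: omul2_mono.
- rewrite /pdom image_set0; apply/card_ltP; split=> //.
  move=> /card_le0P T0; have [k _] := cardinal_inhabited kappa_infinite.
  by have : [set: kappa] k by []; rewrite T0.
Qed.
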